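(* Assume $q\equiv 3\pmod 4$ and let $\rho_\psi=\mathrm{Ind}_{F^\times\mathrm{Sp}(W)}^{\mathrm{GSp}(W)}\pi_\psi$. Then $\rho_\psi$ can be extended to an irreducible representation of $\mathrm{GSp}(W)\ltimes_\alpha\mathrm{Ha}(W)$.
   Context: $F=\mathbb F_q$ is a finite field of odd cardinality; $(W,\langle,\rangle)$ is a symplectic $F$-space of dimension $2m$ with complete polarization $W=X\oplus X^*$, symplectic basis $e_i\in X$, $e_i^*\in X^*$; groups act on $W$ on the right. $\mathrm{GSp}(W)$ is the similitude group, $\lambda:g\mapsto\lambda_g$ the similitude factor, $F^\times\mathrm{Sp}(W)=\{tg: t\in F^\times, g\in\mathrm{Sp}(W)\}=\{h\in\mathrm{GSp}(W):\lambda_h\in F^{\times2}\}$. $\mathrm{Ha}(W)=W\oplus F$ with law $(w,t)+(w',t')=(w+w',t+t'+\tfrac12\langle w,w'\rangle)$. $\psi$ is a non-trivial character of $F$. The Weil representation $\pi_\psi$ of $\mathrm{Sp}(W)$ is realized on $\mathbb C[X]$ (functions on $X$) by: $\pi_\psi\begin{pmatrix}1&b\\0&1\end{pmatrix}f(y)=\psi(\tfrac12\langle y,yb\rangle)f(y)$; $\pi_\psi\begin{pmatrix}a&0\\0&a^{*-1}\end{pmatrix}f(y)=\chi_q^+(\det a)f(ya)$; $\pi_\psi(\omega)f(y)=\gamma(\psi)^{-m}\sum_{x\in X}f(x)\psi(\langle x,y\omega\rangle)$; here $b\in\mathrm{Hom}(X,X^* )$ is symmetric, $a\in\mathrm{Aut}(X)$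 with adjoint $a^*$, $e_i\omega=-e_i^*$, $e_i^*\omega=e_i$, $\gamma(\psi)=\sum_{x\in F}\psi(x^2/2)$, $\chi_q^+$ the Legendre symbol. For $q\equiv3\pmod4$ one has $F^\times=F^{\times2}\times\{\pm1\}$ with $F^{\times 2}$ of odd order; let $\varpi$ be a fixed generator of $F^{\times2}$ and $\tau:F^{\times}\to F^\times$ the homomorphism given by $\varpi^2\mapsto\varpi^{-1}$ on $F^{\times2}$ and trivial on $\{\pm1\}$. The representation $\pi_\psi$ is extended to $F^\times\mathrm{Sp}(W)$ by letting scalars $a\in F^\times$ act by $\pi_\psi\begin{pmatrix}a&0\\0&a\end{pmatrix}f(y)=\chi_q^+(a^m)f(\tau(a^2)ya)$. $\mathrm{GSp}(W)$ acts on the right on $\mathrm{Ha}(W)$ by $\alpha((v,t),g)=(\tau(\lambda_g)vg,\chi_q^+(\lambda_g)t)$, and $\mathrm{GSp}(W)\ltimes_\alpha\mathrm{Ha}(W)$ has elements $[g,h]$ with product $[g,h][g',h']=[gg',\alpha(h,g')+h']$. *)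

(* Defs.v *)
From HB Require Import structures.
From mathcomp Require Import all_boot all_order all_algebra all_fingroup.
From mathcomp Require Import all_solvable all_field.
From mathcomp Require Import zify ring.

Set Implicit Arguments.
Unset Strict Implicit.
Unset Printing Implicit Defensive.

Import GRing.Theory.
Local Open Scope ring_scope.

Lemma linfun_linearE (C : fieldType) (aT rT : vectType C) (f : aT -> rT) :
  linear f -> linfun f =1 f.
Proof.
move=> lin_f x; pose L := GRing.isLinear.Build C aT rT _ f lin_f.
pose l : {linear aT -> rT} := HB.pack f L.
exact: (lfunE l x).
Qed.

(* Representations of a finite group by operators acting on the left of a     *)
(* finite-dimensional space. (MathComp's mx_representation lets matrices act  *)
(* on the right of row vectors, and its modules are spaces of row vectors.)   *)
Section LinearRepresentations.

Variables (C : fieldType) (gT : finGroupType).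

Definition is_linrep (G : {group gT}) (V : vectType C) (rho : gT -> 'End(V)) :=
  rho 1%g = \1%VF
  /\ {in G &, forall g h, rho (g * h)%g = (rho g \o rho h)%VF}.

Definition lin_irreducible (G : {group gT}) (V : vectType C)
    (rho : gT -> 'End(V)) :=
  (fullv : {vspace V}) != 0%VS
  /\ forall U : {vspace V},
       {in G, forall g, (rho g @: U <= U)%VS} -> U = 0%VS \/ U = fullv.

Section Induced.

Variables (G H : {group gT}) (V : vectType C) (rho : gT -> 'End(V)).

(* Functions f : G -> V with f (h x) = rho h (f x) for h in H, x in G. They   *)
(* are coded as functions on gT that vanish outside G; see mem_ind_space.     *)
Definition ind_space : {vspace {ffun gT -> V}} :=
  (\bigcap_(h in H) \bigcap_(x in G)
      lker (linfun (fun f : {ffun gT -> V} => f (h * x)%g - rho h (f x)))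
   :&: \bigcap_(x in ~: G) lker (linfun (fun f : {ffun gT -> V} => f x)))%VS.

(* G acts by right translation; see ind_repE. *)
Definition ind_rep (g : gT) : 'End(subvs_of ind_space) :=
  linfun (fun f : subvs_of ind_space =>
    vsproj ind_space [ffun x => (vsval f : {ffun gT -> V}) (x * g)%g]).

Lemma mem_ind_space (f : {ffun gT -> V}) :
  reflect ({in H & G, forall h x, f (h * x)%g = rho h (f x)}
           /\ {in ~: G, forall x, f x = 0})
          (f \in ind_space).
Proof.
have lin1 h x : linear (fun f : {ffun gT -> V} => f (h * x)%g - rho h (f x)).
  by move=> a u v; rewrite !ffunE linearP scalerBr opprD addrACA.
have lin2 x : linear (fun f : {ffun gT -> V} => f x).
  by move=> a u v; rewrite !ffunE.
have E1 h x : linfun (fun f : {ffun gT -> V} => f (h * x)%g - rho h (f x)) f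
              = f (h * x)%g - rho h (f x).
  exact: linfun_linearE (lin1 h x) f.
have E2 x : linfun (fun f : {ffun gT -> V} => f x) f = f x.
  exact: linfun_linearE (lin2 x) f.
rewrite memv_cap; apply: (iffP andP) => [[/subv_bigcapP Hf /subv_bigcapP Gf]|[Hf Gf]].
  split=> [h x hH xG | x xG].
    move/subv_bigcapP: (Hf h hH) => /(_ x xG); rewrite -memvE memv_ker E1.
    by rewrite subr_eq0 => /eqP.
  by move: (Gf x xG); rewrite -memvE memv_ker E2 => /eqP.
split; apply/subv_bigcapP.
  move=> h hH; apply/subv_bigcapP => x xG.
  by rewrite -memvE memv_ker E1 Hf ?subrr.
by move=> x xG; rewrite -memvE memv_ker E2 Gf.
Qed.

Lemma ind_repE g (f : subvs_of ind_space) x :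
  g \in G ->
  (vsval (ind_rep g f) : {ffun gT -> V}) x = (vsval f : {ffun gT -> V}) (x * g)%g.
Proof.
move=> gG; have lin : linear (fun f : subvs_of ind_space =>
    vsproj ind_space [ffun x => (vsval f : {ffun gT -> V}) (x * g)%g]).
  move=> a u v; rewrite -(linearP (vsproj ind_space)); congr vsproj.
  by apply/ffunP=> y; rewrite !ffunE.
rewrite /ind_rep (linfun_linearE lin) vsprojK ?ffunE //; apply/mem_ind_space.
have /mem_ind_space[Hf Gf] := subvsP f.
split=> [h y hH yG | y yG]; rewrite !ffunE.
  by rewrite -mulgA Hf // groupM.
by apply: Gf; move: yG; rewrite !inE groupMr.
Qed.

End Induced.

End LinearRepresentations.

Section SymplecticSpace.

Variables (F : finFieldType) (n : nat).

(* W = X + X^* has dimension 2m with m = n.+1 > 0; vectors are rows of        *)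
(* coordinates in the symplectic basis e_1 .. e_m, e_1^* .. e_m^*.            *)
Local Notation m := n.+1.
Local Notation X := 'rV[F]_m.
Local Notation W := 'rV[F]_(m + m).
Local Notation GLW := {'GL_(m + m)[F]}.

Definition symp (u v : W) : F :=
  (lsubmx u *m (rsubmx v)^T - rsubmx u *m (lsubmx v)^T) 0 0.

Definition inX (x : X) : W := row_mx x 0.
Definition inXs (x : X) : W := row_mx 0 x.

Definition GLmat (g : GLW) : 'M[F]_(m + m) := GLval g.

Definition similitude (l : {unit F}) (g : GLW) : bool :=
  [forall u : W, forall v : W,
     symp (u *m GLmat g) (v *m GLmat g) == val l * symp u v].

Definition sp_set : {set GLW} := [set g | similitude 1%g g].
Definition gsp_set : {set GLW} := [set g | [exists l, similitude l g]].
Definition fsp_set : {set GLW} :=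
  [set g | [exists t : {unit F}, exists h in sp_set,
              GLmat g == val t *: GLmat h]].

(* The similitude factor, with junk value 1 outside GSp(W). *)
Definition lambda (g : GLW) : {unit F} :=
  odflt 1%g [pick l | similitude l g].

Lemma sympE u v :
  symp u v = \sum_(i < m) (lsubmx u 0 i * rsubmx v 0 i
                           - rsubmx u 0 i * lsubmx v 0 i).
Proof.
rewrite /symp sumrB mxE; congr (_ + _); rewrite !mxE ?sumrN; last congr (- _).
  by apply: eq_bigr => i _; rewrite !mxE.
by apply: eq_bigr => i _; rewrite !mxE.
Qed.

Lemma symp_lin a u u' v : symp (a *: u + u') v = a * symp u v + symp u' v.
Proof.
rewrite !sympE mulr_sumr -big_split; apply: eq_bigr => i _ /=.
rewrite !mxE; ring.
Qed.

Lemma symp_anti u v : symp u v = - symp v u.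
Proof. rewrite !sympE -sumrN; apply: eq_bigr => i _; ring. Qed.

Lemma sympDl u u' v : symp (u + u') v = symp u v + symp u' v.
Proof. by rewrite -[u]scale1r symp_lin mul1r scale1r. Qed.

Lemma sympDr u v v' : symp u (v + v') = symp u v + symp u v'.
Proof. by rewrite symp_anti sympDl opprD -!symp_anti. Qed.

Lemma sympZl a u v : symp (a *: u) v = a * symp u v.
Proof.
have s0 : symp 0 v = 0 by apply: (addrI (symp 0 v)); rewrite -sympDl !addr0.
by rewrite -[a *: u]addr0 symp_lin s0 addr0.
Qed.

Lemma sympZr a u v : symp u (a *: v) = a * symp u v.
Proof. by rewrite symp_anti sympZl -mulrN -symp_anti. Qed.

Lemma symp_self u : symp u u = 0.
Proof. rewrite sympE big1 // => i _; ring. Qed.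

Lemma similitudeP l g :
  reflect (forall u v, symp (u *m GLmat g) (v *m GLmat g) = val l * symp u v)
          (similitude l g).
Proof.
apply: (iffP forallP) => [H u v|H u].
  by have /forallP/(_ v)/eqP := H u.
by apply/forallP=> v; rewrite H.
Qed.

Lemma GLmatM g h : GLmat (g * h)%g = GLmat g *m GLmat h.
Proof. by []. Qed.

Lemma GLmat1 : GLmat 1%g = 1%:M.
Proof. by []. Qed.

Lemma similitude1 : similitude 1%g 1%g.
Proof. by apply/similitudeP=> u v; rewrite GLmat1 !mulmx1 mul1r. Qed.

Lemma similitudeM l l' g g' :
  similitude l g -> similitude l' g' -> similitude (l * l')%g (g * g')%g.
Proof.
move=> /similitudeP Hg /similitudeP Hg'; apply/similitudeP=> u v.
by rewrite GLmatM !mulmxA Hg' Hg mulrA /= (mulrC (val l')).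
Qed.

Lemma similitude_inj l l' g : similitude l g -> similitude l' g -> l = l'.
Proof.
move=> /similitudeP Hl /similitudeP Hl'; apply: val_inj.
pose u := inX (delta_mx 0 0); pose v := inXs (delta_mx 0 0).
have uv1 : symp u v = 1.
  rewrite /symp !row_mxKl !row_mxKr !mul0mx subr0 trmx_delta mul_delta_mx.
  by rewrite mxE !eqxx.
by have := Hl u v; rewrite Hl' uv1 !mulr1.
Qed.

Lemma lambdaP g : g \in gsp_set -> similitude (lambda g) g.
Proof.
rewrite inE /lambda => /existsP[l Hl].
by case: pickP => [//|/(_ l)]; rewrite Hl.
Qed.

Lemma lambdaM : {in gsp_set &, {morph lambda : g h / (g * h)%g}}.
Proof.
move=> g h gG hG; apply: (@similitude_inj _ _ (g * h)%g).
  apply: lambdaP; rewrite inE; apply/existsP; exists (lambda g * lambda h)%g.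
  exact: similitudeM (lambdaP gG) (lambdaP hG).
exact: similitudeM (lambdaP gG) (lambdaP hG).
Qed.

Lemma sp_set1 : 1%g \in sp_set.
Proof. by rewrite inE similitude1. Qed.

Lemma sp_setM g h : g \in sp_set -> h \in sp_set -> (g * h)%g \in sp_set.
Proof. by rewrite !inE => Hg Hh; have := similitudeM Hg Hh; rewrite mulg1. Qed.

Lemma sp_group_set : group_set sp_set.
Proof.
apply/group_setP; split; [exact: sp_set1 | exact: sp_setM].
Qed.
Canonical Sp := Group sp_group_set.

Lemma gsp_group_set : group_set gsp_set.
Proof.
apply/group_setP; split=> [|g h].
  by rewrite inE; apply/existsP; exists 1%g; apply: similitude1.
move=> gG hG; rewrite inE; apply/existsP; exists (lambda g * lambda h)%g.
exact: similitudeM (lambdaP gG) (lambdaP hG).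
Qed.
Canonical GSp := Group gsp_group_set.

Lemma fsp_group_set : group_set fsp_set.
Proof.
apply/group_setP; split=> [|g h].
  rewrite inE; apply/existsP; exists 1%g; apply/existsP; exists 1%g.
  by apply/andP; split; [apply: sp_set1 | rewrite scale1r].
rewrite inE => /existsP[t /existsP[g' /andP[Hg' /eqP Eg]]].
rewrite inE => /existsP[s /existsP[h' /andP[Hh' /eqP Eh]]].
rewrite inE; apply/existsP; exists (t * s)%g; apply/existsP; exists (g' * h')%g.
apply/andP; split; first exact: sp_setM Hg' Hh'.
by rewrite !GLmatM Eg Eh -scalemxAl -scalemxAr scalerA.
Qed.
Canonical FSp := Group fsp_group_set.

Definition Heis : Type := (W * F)%type.

HB.instance Definition _ := Finite.on Heis.

Definition heis_mul (h k : Heis) : Heis :=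
  (h.1 + k.1, h.2 + k.2 + 2^-1 * symp h.1 k.1).
Definition heis_one : Heis := (0, 0).
Definition heis_inv (h : Heis) : Heis := (- h.1, - h.2).

Lemma heis_mulA : associative heis_mul.
Proof.
move=> [u a] [v b] [w c]; rewrite /heis_mul /= addrA sympDl sympDr.
by congr pair; ring.
Qed.

Lemma heis_mul1 : left_id heis_one heis_mul.
Proof.
move=> [u a]; rewrite /heis_mul /= !add0r -(scale0r (0 : W)) sympZl mul0r mulr0.
by rewrite addr0.
Qed.

Lemma heis_mulV : left_inverse heis_one heis_inv heis_mul.
Proof.
move=> [u a]; rewrite /heis_mul /= addNr -scaleN1r sympZl symp_self !mulr0 addr0.
by rewrite addNr.
Qed.

HB.instance Definition _ :=
  Finite_isGroup.Build Heis heis_mulA heis_mul1 heis_mulV.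

End SymplecticSpace.

Arguments GLmat : simpl never.

Definition legendre (F : finFieldType) (a : F) : int :=
  if a == 0 then 0 else if [exists b : F, b ^+ 2 == a] then 1 else -1.

Section Alpha.

Variables (F : finFieldType) (n : nat).
Local Notation m := n.+1.
Local Notation GLW := {'GL_(m + m)[F]}.

Definition unitN1 : {unit F} := FinRing.unit F (unitrN1 F).

(* varpi generates the group of squares of F^*, and tau is the endomorphism   *)
(* of F^* with varpi^2 |-> varpi^-1 and -1 |-> 1.                             *)
Definition is_tau (varpi : {unit F})
    (tau : {morphism [set: {unit F}] >-> {unit F}}) : Prop :=
  [/\ <[varpi]>%g = [set (u ^+ 2)%g | u : {unit F}],
      tau (varpi ^+ 2)%g = varpi^-1%g & tau unitN1 = 1%g].

Definition alpha_fun (tau : {morphism [set: {unit F}] >-> {unit F}})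
    (h : Heis F n) (g : GLW) : Heis F n :=
  (val (tau (lambda g)) *: (h.1 *m GLmat g),
   (legendre (val (lambda g)))%:~R * h.2).

Variables (varpi : {unit F}) (tau : {morphism [set: {unit F}] >-> {unit F}}).
Hypothesis hq : (#|F| %% 4 = 3)%N.
Hypothesis htau : is_tau varpi tau.

Lemma val_unitN1 : val unitN1 = -1.
Proof. by []. Qed.

Lemma unitN1_sq : (unitN1 ^+ 2)%g = 1%g.
Proof. by apply: val_inj; rewrite /= mulrNN mulr1. Qed.

Lemma unit_mulC (u v : {unit F}) : (u * v)%g = (v * u)%g.
Proof. by apply: val_inj; rewrite /= mulrC. Qed.

Lemma card_unit4 : exists k, #|[set: {unit F}]| = (k.*2.+1).*2.
Proof.
rewrite card_finField_unit; exists (#|F| %/ 4)%N.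
rewrite {1}(divn_eq #|F| 4) hq; lia.
Qed.

Lemma oneN1_neq : (-1 : F) != 1.
Proof.
apply/eqP=> E; have two0 : (2%:R : F) = 0 by rewrite mulrS -{1}E addNr.
have c0 : (#|F|%:R : F) = 0.
  have := @expg_cardG F [set: F]%G (GRing.one F) (in_setT _).
  by rewrite FinRing.zmodXgE cardsT.
have /eqP := c0; rewrite (divn_eq #|F| 4) hq.
rewrite natrD natrM (natrM F 2 2) two0 !mulr0 add0r (natrD F 2 1) two0 add0r.
by rewrite oner_eq0.
Qed.

Lemma unit_sq_or (u : {unit F}) :
  exists s : {unit F}, u = (s ^+ 2)%g \/ u = (unitN1 * s ^+ 2)%g.
Proof.
have [k hk] := card_unit4; exists (u ^+ k.+1)%g.
have := @expg_cardG _ [set: {unit F}]%G u (in_setT _); rewrite hk => h2.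
have Es : ((u ^+ k.+1) ^+ 2 = u ^+ k.*2.+1 * u)%g.
  by rewrite -expgM -expgSr; congr (_ ^+ _)%g; lia.
have : val (u ^+ k.*2.+1)%g ^+ 2 == 1.
  by rewrite -FinRing.val_unitX -expgM muln2 h2.
rewrite sqrf_eq1 => /orP[]/eqP Ev; [left|right]; rewrite Es; apply: val_inj.
  by rewrite FinRing.val_unitM Ev mul1r.
by rewrite !FinRing.val_unitM Ev val_unitN1 mulrA mulrNN mulr1 mul1r.
Qed.

Lemma N1_nsq (s : {unit F}) : (s ^+ 2)%g != unitN1.
Proof.
have [k hk] := card_unit4; apply/eqP=> Es.
have := @expg_cardG _ [set: {unit F}]%G s (in_setT _).
rewrite hk -mul2n expgM Es expgS -mul2n expgM unitN1_sq expg1n mulg1.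
move=> /(congr1 val) /= /eqP; exact/negP/oneN1_neq.
Qed.

Lemma tau_sq (s : {unit F}) : (tau (s ^+ 2) ^+ 2 * s ^+ 2)%g = 1%g.
Proof.
have [gen tau2 _] := htau; have [k hk] := card_unit4.
have : (s ^+ 2)%g \in <[varpi]>%g by rewrite gen; apply: imset_f.
case/cycleP=> i ->.
have : varpi \in [set (u ^+ 2)%g | u : {unit F}] by rewrite -gen cycle_id.
case/imsetP=> w _ Ew.
have ord : (varpi ^+ k.*2.+1)%g = 1%g.
  by rewrite Ew -expgM mul2n -hk expg_cardG ?inE.
have -> : (varpi ^+ i)%g = ((varpi ^+ 2) ^+ (k.+1 * i))%g.
  rewrite -expgM (_ : (2 * (k.+1 * i) = k.*2.+1 * i + i)%N); last by nia.
  by rewrite expgD expgM ord expg1n mul1g.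
rewrite morphX ?inE // tau2 -!expgM expVgn mulnC; exact: mulVg.
Qed.

Lemma legendre_tau (u : {unit F}) :
  (legendre (val u))%:~R = val (tau u ^+ 2 * u)%g :> F.
Proof.
have u0 : (val u == 0) = false.
  by apply/negbTE; rewrite -unitfE; apply: valP.
rewrite /legendre u0; have [s [Eu|Eu]] := unit_sq_or u.
  rewrite ifT; last by apply/existsP; exists (val s); rewrite Eu FinRing.val_unitX.
  by rewrite Eu tau_sq.
rewrite ifF; last first.
  apply/existsP=> -[b /eqP Eb].
  have bU : b \is a GRing.unit.
    by rewrite unitfE; apply/eqP=> b0; rewrite -Eb b0 expr0n eqxx in u0.
  pose b' := FinRing.unit F bU.
  have /eqP := N1_nsq (b' * s^-1)%g; apply.
  rewrite expgMn; last exact: unit_mulC.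
  have -> : (b' ^+ 2)%g = u by apply: val_inj; rewrite FinRing.val_unitX.
  by rewrite Eu expVgn mulgK.
have [_ _ tau1] := htau.
rewrite Eu morphM ?inE // tau1 mul1g [(_ * (unitN1 * _))%g]unit_mulC -mulgA.
by rewrite [(s ^+ 2 * _)%g]unit_mulC tau_sq mulg1.
Qed.

Lemma legendre_tauE (u : {unit F}) :
  (legendre (val u))%:~R = val (tau u) ^+ 2 * val u :> F.
Proof. by rewrite legendre_tau; move: (tau u) => t; rewrite !expgS !expg0 /=; ring. Qed.

Lemma legendre_unitM (u v : {unit F}) :
  (legendre (val (u * v)%g))%:~R
    = (legendre (val u))%:~R * (legendre (val v))%:~R :> F.
Proof.
rewrite !legendre_tau morphM ?inE //.
move: (tau u) (tau v) => tu tv; rewrite !expgS !expg0 /=; ring.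
Qed.

Lemma alpha_act : is_action (GSp F n) (alpha_fun tau).
Proof.
split=> [g [u a] [v b] [E1 E2]|[u a] g h gG hG]; last first.
  rewrite /alpha_fun (lambdaM gG hG) legendre_unitM morphM ?inE //.
  rewrite FinRing.val_unitM GLmatM; cbv [fst snd].
  move: (lambda g) (lambda h) (GLmat g) (GLmat h) => l l' M N.
  by rewrite -scalemxAl scalerA mulmxA mulrA ![_ (tau l) * _]mulrC
             [_%:~R * _%:~R]mulrC.
have nz (w : {unit F}) : val w != 0 by rewrite -unitfE; apply: valP.
congr pair.
  have E : u *m GLmat g = v *m GLmat g by apply: scalerI (nz _) _ _ E1.
  have Ug : GLmat g \in unitmx.
    by have := congr1 (@GLmat F n) (mulgV g); rewrite GLmatM GLmat1; case/mulmx1_unit.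
  by rewrite -(mulmxK Ug u) E mulmxK.
by move: E2; rewrite legendre_tau; apply: mulfI (nz _) _ _.
Qed.

Definition alpha_action : action (GSp F n) (Heis F n) := Action alpha_act.

Lemma alpha_gact : is_groupAction [set: Heis F n] alpha_action.
Proof.
move=> g gG; rewrite /= inE; apply/andP; split.
  by apply/subsetP=> x; rewrite inE.
apply/morphicP=> -[u a] [v b] _ _; rewrite !actpermE /=.
have /similitudeP lg := lambdaP gG.
rewrite /alpha_fun /mulg /= /heis_mul /=; congr pair.
  by rewrite mulmxDl scalerDr.
rewrite sympZl sympZr lg legendre_tauE {lg gG}.
move: (symp u v) => s; move: (lambda g) => l; move: (tau l) => t /=; ring.
Qed.

(* Elements of sdprod_by alpha are pairs (g, h), multiplied by                *)
(* (g, h) (g', h') = (g g', alpha h g' * h'), and sdpair2 g = (g, 1).         *)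
Definition alpha : groupAction (GSp F n) [set: Heis F n] :=
  GroupAction alpha_gact.

End Alpha.


Section WeilRepresentation.

Variables (F : finFieldType) (n : nat) (C : fieldType).
Local Notation m := n.+1.
Local Notation X := 'rV[F]_m.
Local Notation GLW := {'GL_(m + m)[F]}.

Definition nontriv_add_char (psi : F -> C) : Prop :=
  [/\ psi 0 = 1, {morph psi : x y / x + y >-> x * y} & exists x, psi x != 1].

Definition gauss_sum (psi : F -> C) : C := \sum_(x : F) psi (x ^+ 2 / 2).

(* The formulas below prescribe pi on generators of F^* Sp(W). A linear map   *)
(* X -> X^* is given by its matrix b in the bases e_i and e_i^*, so that it   *)
(* is symmetric iff b^T = b, and the adjoint of a in Aut(X), acting on X^*,   *)
(* has matrix a^T.                                                            *)
Record weil_formulas (psi : F -> C)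
    (tau : {morphism [set: {unit F}] >-> {unit F}})
    (pi : GLW -> 'End({ffun X -> C^o})) : Prop := WeilFormulas {
  weil_unipotent : forall (g : GLW) (b : 'M[F]_m),
    b^T = b -> GLmat g = block_mx 1%:M b 0 1%:M ->
    forall f y, pi g f y = psi (2^-1 * symp (inX y) (inXs (y *m b))) * f y;
  weil_levi : forall (g : GLW) (a : 'M[F]_m),
    a \in unitmx -> GLmat g = block_mx a 0 0 (invmx a^T) ->
    forall f y, pi g f y = (legendre (\det a))%:~R * f (y *m a);
  weil_omega : forall g : GLW,
    GLmat g = block_mx 0 (- 1%:M) 1%:M 0 ->
    forall f y, pi g f y =
      gauss_sum psi ^- m *
      \sum_(x : X) f x * psi (symp (inX x) (inX y *m GLmat g));
  weil_scalar : forall (g : GLW) (a : {unit F}),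
    GLmat g = (val a)%:M ->
    forall f y, pi g f y =
      (legendre (val a ^+ m))%:~R * f (val (tau (a ^+ 2)%g) *: (val a *: y))
}.

End WeilRepresentation.

(* Main.v *)
Require Import Defs.
From HB Require Import structures.
From mathcomp Require Import all_boot all_order all_algebra all_fingroup.
From mathcomp Require Import all_solvable all_field.
From mathcomp Require Import complex reals.
From mathcomp Require Import ring.

(** The Heisenberg group acts on C[X] by the Schroedinger representation S, in
    which (u + v, t) sends f to y |-> psi (t + y.v + u.v / 2) f (y + u). The
    Weil representation is exactly what carries S to its conjugates:

      S h o pi g = pi g o S (alpha h g)   for every g in F^* Sp(W).

    The elements g with this property form a group, so it is enough to compute
    with the given formulas on the scalars and on the Siegel unipotents, the
    Levi elements and omega, which generate Sp(W) (sp_sub_generated). On the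
    scalar a, the map tau is chosen so that tau (a^2) a is a sign, which is
    what makes f |-> f (tau (a^2) a y) compatible with alpha.

    The intertwining relation makes the operators

      (Phi h f) x = S (alpha h x^-1) (f x)

    preserve the induced space, and Phi h o rho g = rho g o Phi (alpha h g) is
    then formal, so that [g, h] |-> rho g o Phi h is a representation extending
    rho (ext_rep_linrep).

    For irreducibility, -1 is not a square, so GSp(W) is the union of
    F^* Sp(W) and one further coset, that of c = diag(1, -1). The centre
    {(0, t)} of the Heisenberg group acts by psi (t) on the functions supported
    on F^* Sp(W), and by psi (- t) on those supported on the other coset,
    because alpha ((0, t), g) = (0, chi (lambda g) t). As psi is nontrivial and
    q is odd, averaging over the centre against psi projects onto the first
    summand (center_projection). An invariant subspace that is not zero
    therefore meets this summand, after a translation by some rho x; the summand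
    is a copy of the irreducible module C[X] (schrodinger_irr), so it lies in
    the subspace, and so does its translate by c, which is the other summand. *)

Set Implicit Arguments.
Unset Strict Implicit.
Unset Printing Implicit Defensive.
Import GRing.Theory.
Local Open Scope ring_scope.

(** * Generators of the symplectic group *)

(** The rows (A B) span a Lagrangian subspace when A B^T is symmetric and the
    rows are independent, and A + B s is invertible when this subspace is
    transverse to the graph of - s : X^* -> X. With A = L p R, where L and R are
    invertible and p = diag(1, .., 1, 0, .., 0), the matrix s = R^T (1 - p) R
    fills in the kernel of A: if z (A + B s) = 0, multiplication by R^-1 p on
    the right gives z A = 0, and the symmetry of A B^T then turns the rest into
    z B = 0. *)
Lemma exists_sym_unitmx (K : fieldType) (m : nat) (A B : 'M[K]_m) :
  A *m B^T = B *m A^T ->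
  (forall z : 'rV_m, z *m A = 0 -> z *m B = 0 -> z = 0) ->
  exists2 s : 'M[K]_m, s^T = s & A + B *m s \in unitmx.
Proof.
move=> sAB inj; set p : 'M[K]_m := pid_mx (\rank A).
set L := col_ebase A; set R := row_ebase A.
have LU : L \in unitmx := col_ebase_unit A.
have RU : R \in unitmx := row_ebase_unit A.
have EA : A = L *m p *m R by rewrite mulmx_ebase.
have pT : p^T = p by rewrite /p tr_pid_mx.
have pp : p *m p = p.
  by rewrite /p mul_pid_mx !minnn; congr pid_mx; apply/minn_idPr/rank_leq_row.
exists (R^T *m (1%:M - p) *m R).
  by rewrite !trmx_mul trmxK [(_ - _)^T]linearB /= trmx1 pT mulmxA.
rewrite -row_free_unit -kermx_eq0; apply/eqP/row_matrixP=> i; rewrite row0.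
set z := row i _.
have zk : z *m (A + B *m (R^T *m (1%:M - p) *m R)) = 0.
  by rewrite -row_mul mulmx_ker row0.
have {zk} : (z *m L *m p + z *m B *m R^T *m (1%:M - p)) *m R = 0.
  by rewrite -zk EA [z *m (_ + _)]mulmxDr mulmxDl !mulmxA.
move/(congr1 (mulmx^~ (invmx R))); rewrite mulmxK // mul0mx => zk.
have zA : z *m L *m p = 0.
  have := congr1 (mulmx^~ p) zk; rewrite mulmxDl -!mulmxA pp mulmxBl pp mul1mx.
  by rewrite subrr !mulmx0 addr0 mul0mx.
have zBp : z *m B *m R^T *m p = 0.
  have : z *m (A *m B^T) = 0 by rewrite EA !mulmxA zA !mul0mx.
  rewrite sAB EA !trmx_mul pT !mulmxA => /(congr1 (mulmx^~ (invmx L^T))).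
  by rewrite mulmxK ?unitmx_tr // mul0mx.
apply: inj; first by rewrite EA !mulmxA zA mul0mx.
move: zk; rewrite zA add0r mulmxBr mulmx1 zBp subr0.
move/(congr1 (mulmx^~ (invmx R^T))).
by rewrite mulmxK ?unitmx_tr // mul0mx.
Qed.

Definition simp_mx := (@mulmx0, @mul0mx, @mulmxN, @mulNmx, @mulmx1, @mul1mx,
  @opprK, @oppr0, @subr0, @add0r, @addr0).

Section Generation.

Variables (F : finFieldType) (n : nat).
Local Notation m := n.+1.
Local Notation W := 'rV[F]_(m + m).
Local Notation GLW := {'GL_(m + m)[F]}.

(** The Gram matrix of the symplectic form in the basis e_i, e_i^*. *)
Definition sympJ : 'M[F]_(m + m) := block_mx 0 1%:M (- 1%:M) 0.

Lemma symp_mx (u v : W) : symp u v = (u *m sympJ *m v^T) 0 0.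
Proof.
rewrite /symp /sympJ -{3}[u]hsubmxK -{3}[v]hsubmxK.
rewrite mul_row_block tr_row_mx mul_row_col !mulmx0 !mulmx1 mulmxN mulmx1.
by rewrite add0r addr0 mulNmx addrC.
Qed.

Lemma similitude_mx (l : {unit F}) (g : GLW) :
  similitude l g <-> GLmat g *m sympJ *m (GLmat g)^T = val l *: sympJ.
Proof.
split=> [/similitudeP H | H].
  apply/matrixP=> i j.
  have mxE2 (M : 'M[F]_(m + m)) :
      M i j = ((delta_mx 0 i : W) *m M *m (delta_mx 0 j : W)^T) 0 0.
    by rewrite trmx_delta -rowE -colE !mxE.
  rewrite mxE2 [RHS]mxE [sympJ i j]mxE2 -symp_mx -H symp_mx.
  by rewrite trmx_mul !mulmxA.
apply/similitudeP=> u v; rewrite !symp_mx trmx_mul.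
have -> M : u *m M *m sympJ *m (M^T *m v^T) = u *m (M *m sympJ *m M^T) *m v^T.
  by rewrite !mulmxA.
by rewrite H -scalemxAr -scalemxAl mxE.
Qed.

Definition GLof (M : 'M[F]_(m + m)) : GLW := insubd (1%g : GLW) M.

Lemma GLofK (M : 'M[F]_(m + m)) : M \in unitmx -> GLmat (GLof M) = M.
Proof. by move=> uM; exact: (@insubdK _ _ _ (1%g : GLW) M uM). Qed.

Lemma GLmat_inj : injective (@GLmat F n).
Proof. exact: val_inj. Qed.

Lemma GLmat_unit (g : GLW) : GLmat g \in unitmx.
Proof.
by have := congr1 (@GLmat F n) (mulgV g); rewrite GLmatM GLmat1; case/mulmx1_unit.
Qed.

(** The three families below carry the names of the parts of Sp(W) that they
    come from: the unipotent radical and the Levi factor of the Siegel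
    parabolic, which is the stabilizer of X^*, and the Weyl element omega. *)
Definition siegel (b : 'M[F]_m) : GLW := GLof (block_mx 1%:M b 0 1%:M).
Definition levi (a : 'M[F]_m) : GLW := GLof (block_mx a 0 0 (invmx a^T)).
Definition weyl : GLW := GLof (block_mx 0 (- 1%:M) 1%:M 0).

Lemma siegelE b : GLmat (siegel b) = block_mx 1%:M b 0 1%:M.
Proof. by apply: GLofK; rewrite unitmxE det_ublock !det1 mulr1 unitr1. Qed.

Lemma leviE a : a \in unitmx -> GLmat (levi a) = block_mx a 0 0 (invmx a^T).
Proof.
move=> aU; apply: GLofK; rewrite unitmxE det_ublock unitrM -!unitmxE aU.
by rewrite unitmx_inv unitmx_tr.
Qed.

Lemma weylE : GLmat weyl = block_mx 0 (- 1%:M) 1%:M 0.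
Proof.
apply: GLofK; have /mulmx1_unit[] // :
  (block_mx 0 (- 1%:M) 1%:M 0 : 'M[F]_(m + m)) *m block_mx 0 1%:M (- 1%:M) 0
    = 1%:M.
rewrite mulmx_block !mulmx0 !mul0mx !mulmx1 mulNmx mulmxN mul1mx opprK.
by rewrite add0r !addr0 scalar_mx_block.
Qed.

Lemma siegel_sp b : b^T = b -> siegel b \in Sp F n.
Proof.
move=> sb; rewrite inE; apply/similitude_mx; rewrite siegelE /sympJ tr_block_mx.
rewrite !trmx1 sb trmx0 !mulmx_block ?simp_mx.
by rewrite addNr scale1r.
Qed.

Lemma levi_sp a : a \in unitmx -> levi a \in Sp F n.
Proof.
move=> aU; rewrite inE; apply/similitude_mx.
rewrite leviE // /sympJ tr_block_mx.
rewrite trmx_inv trmxK !trmx0.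
rewrite !mulmx_block ?simp_mx.
by rewrite scale1r mulmxV // mulVmx ?unitmx_tr.
Qed.

Lemma weyl_sp : weyl \in Sp F n.
Proof.
rewrite inE; apply/similitude_mx; rewrite weylE // /sympJ tr_block_mx.
rewrite linearN /= !trmx1 !trmx0.
rewrite !mulmx_block ?simp_mx.
by rewrite scale1r.
Qed.

(** An element (A B; C D) of Sp(W) with A invertible is the product of a lower
    unipotent, a Levi element and an upper unipotent; the lower unipotents are
    the conjugates of the upper ones by omega. Right multiplication by a lower
    unipotent replaces A by A + B s, which is invertible for a suitable
    symmetric s, since A B^T is symmetric. *)
Lemma sp_sub_generated (K : {group GLW}) :
  (forall b, b^T = b -> siegel b \in K) ->
  (forall a, a \in unitmx -> levi a \in K) ->
  weyl \in K -> Sp F n \subset K.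
Proof.
move=> Ksiegel Klevi Kweyl.
pose lower c := (weyl * siegel (- c) * weyl^-1)%g.
have lowerE c : GLmat (lower c) = block_mx 1%:M 0 c 1%:M.
  have E : (lower c * weyl)%g = (weyl * siegel (- c))%g by rewrite /lower mulgKV.
  have := congr1 (@GLmat F n) E; rewrite !GLmatM weylE siegelE.
  move=> /(congr1 (mulmx^~ (block_mx 0 1%:M (- 1%:M) 0))).
  rewrite -!mulmxA -weylE.
  have -> : GLmat weyl *m block_mx 0 1%:M (- 1%:M) 0 = 1%:M.
    rewrite weylE mulmx_block ?simp_mx.
    by rewrite scalar_mx_block.
  rewrite mulmx1 => ->.
  by rewrite weylE !mulmx_block ?simp_mx.
have lower_sp c : c^T = c -> lower c \in Sp F n.
  move=> sc; rewrite !groupM ?groupV ?weyl_sp ?siegel_sp //.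
  by rewrite linearN /= sc.
have lowerK c : c^T = c -> lower c \in K.
  move=> sc; rewrite !groupM ?groupV ?Ksiegel //.
  by rewrite linearN /= sc.
have spE (g : GLW) : g \in Sp F n ->
    let A := ulsubmx (GLmat g) in let B := ursubmx (GLmat g) in
    let C := dlsubmx (GLmat g) in let D := drsubmx (GLmat g) in
    [/\ A *m B^T = B *m A^T, A *m D^T - B *m C^T = 1%:M & C *m D^T = D *m C^T].
  rewrite inE => /similitude_mx /=.
  rewrite -{1 2}[GLmat g]submxK /sympJ tr_block_mx.
  rewrite !mulmx_block ?simp_mx scale1r => /eq_block_mx[E1 E2 _ E4].
  by split; [apply/eqP; rewrite -subr_eq0 -E1 addrC | rewrite -E2 addrC
            |apply/eqP; rewrite -subr_eq0 -E4 addrC].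
have tri (g : GLW) : g \in Sp F n -> ulsubmx (GLmat g) \in unitmx ->
    ursubmx (GLmat g) = 0 -> g \in K.
  move=> gSp AU B0; have [_ + +] := spE g gSp; rewrite B0 mul0mx subr0.
  set A := ulsubmx _ in AU *; set C := dlsubmx _; set D := drsubmx _.
  move=> AD CD; have ED : D = invmx A^T.
    by rewrite -[D]trmxK -[D^T](mulKmx AU) AD mulmx1 trmx_inv.
  have sc : (C *m invmx A)^T = C *m invmx A.
    rewrite trmx_mul trmx_inv -ED -CD; congr (_ *m _).
    by rewrite ED trmx_inv trmxK.
  have -> : g = (lower (C *m invmx A) * levi A)%g.
    apply: GLmat_inj; rewrite GLmatM lowerE leviE // -[LHS]submxK -/A -/C -/D B0.
    rewrite mulmx_block ?simp_mx.
    by rewrite mulmxKV // ED.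
  by rewrite groupM ?lowerK ?Klevi.
have corner (g : GLW) : g \in Sp F n -> ulsubmx (GLmat g) \in unitmx -> g \in K.
  move=> gSp AU; have [AB _ _] := spE g gSp.
  set A := ulsubmx _ in AU AB *; set B := ursubmx _ in AB.
  have sb : (- (invmx A *m B))^T = - (invmx A *m B).
    rewrite linearN /= trmx_mul trmx_inv; congr (- _).
    by rewrite -[B^T](mulKmx AU) AB !mulmxA mulmxK ?unitmx_tr.
  set b := - _ in sb; rewrite -(groupMr _ (Ksiegel b sb)).
  apply: tri; first by rewrite groupM ?siegel_sp.
    rewrite GLmatM siegelE -[GLmat g]submxK mulmx_block block_mxKul.
    by rewrite mulmx1 mulmx0 addr0.
  rewrite GLmatM siegelE -[GLmat g]submxK mulmx_block block_mxKur.
  by rewrite mulmx1 -/A -/B mulmxN mulmxA mulmxV // mul1mx addNr.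
apply/subsetP=> g gSp; have [AB AD _] := spE g gSp.
have inj (z : 'rV_m) :
    z *m ulsubmx (GLmat g) = 0 -> z *m ursubmx (GLmat g) = 0 -> z = 0.
  by move=> zA zB; rewrite -[z]mulmx1 -AD mulmxBr !mulmxA zA zB !mul0mx subr0.
have [s ss U] := exists_sym_unitmx AB inj.
rewrite -(groupMr _ (lowerK s ss)); apply: corner.
  by rewrite groupM ?lower_sp.
by rewrite GLmatM lowerE -[GLmat g]submxK mulmx_block block_mxKul mulmx1.
Qed.

End Generation.

(** * The Schroedinger representation of the Heisenberg group *)

Section Schrodinger.

Variables (F : finFieldType) (n : nat) (C : fieldType) (psi : F -> C).
Hypothesis hpsi : nontriv_add_char psi.
Local Notation m := n.+1.
Local Notation X := 'rV[F]_m.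
Local Notation W := 'rV[F]_(m + m).
Local Notation V := {ffun X -> C^o}.

Definition dot (x y : X) : F := (x *m y^T) 0 0.

Lemma dotE x y : dot x y = \sum_i x 0 i * y 0 i.
Proof. by rewrite /dot mxE; apply: eq_bigr => i _; rewrite mxE. Qed.

Lemma dotC x y : dot x y = dot y x.
Proof. by rewrite !dotE; apply: eq_bigr => i _; rewrite mulrC. Qed.

Lemma dotDl x x' y : dot (x + x') y = dot x y + dot x' y.
Proof. by rewrite /dot mulmxDl mxE. Qed.

Lemma dotDr x y y' : dot x (y + y') = dot x y + dot x y'.
Proof. by rewrite dotC dotDl !(dotC x). Qed.

Lemma dotZl a x y : dot (a *: x) y = a * dot x y.
Proof. by rewrite /dot -scalemxAl mxE. Qed.

Lemma dotZr a x y : dot x (a *: y) = a * dot x y.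
Proof. by rewrite dotC dotZl (dotC x). Qed.

Lemma dotNl x y : dot (- x) y = - dot x y.
Proof. by rewrite -scaleN1r dotZl mulN1r. Qed.

Lemma dotNr x y : dot x (- y) = - dot x y.
Proof. by rewrite dotC dotNl (dotC x). Qed.

Lemma dot0l y : dot 0 y = 0.
Proof. by rewrite /dot mul0mx mxE. Qed.

Lemma dot0r x : dot x 0 = 0.
Proof. by rewrite dotC dot0l. Qed.

Lemma dotM x y (a : 'M[F]_m) : dot (x *m a) y = dot x (y *m a^T).
Proof. by rewrite /dot trmx_mul trmxK mulmxA. Qed.

Lemma symp_dot (u v : W) :
  symp u v = dot (lsubmx u) (rsubmx v) - dot (rsubmx u) (lsubmx v).
Proof. by rewrite /symp /dot !mxE. Qed.

Lemma psi0 : psi 0 = 1. Proof. by case: hpsi. Qed.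
Lemma psiD x y : psi (x + y) = psi x * psi y. Proof. by case: hpsi => _ ->. Qed.

(** Translating the summation variable by a^-1 x multiplies the sum by psi x,
    and some psi x differs from 1. *)
Lemma psi_sum_mul (a : F) : a != 0 -> \sum_t psi (a * t) = 0.
Proof.
move=> a0; have [_ _ [x px]] := hpsi.
have : \sum_t psi (a * t) = psi x * \sum_t psi (a * t).
  rewrite [LHS](reindex_inj (addIr (a^-1 * x))) mulr_sumr; apply: eq_bigr => t _.
  by rewrite mulrDr mulVKf // psiD mulrC.
move/eqP; rewrite -subr_eq0 -{1}[\sum_t _]mul1r -mulrBl mulf_eq0 subr_eq0.
by rewrite eq_sym (negPf px) => /eqP.
Qed.

(** Orthogonality of the characters v |-> psi (z.v) of X. *)
Lemma psi_sum_dot (z : X) :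
  \sum_(v : X) psi (dot z v) = if z == 0 then (#|{: X}|)%:R else 0.
Proof.
case: eqP => [-> | /eqP z0].
  by under eq_bigr do rewrite dot0l psi0; rewrite sumr_const.
have [i zi] : exists i, z 0 i != 0.
  apply/existsP; apply: contraNT z0 => /existsPn H; apply/eqP/rowP=> i.
  by rewrite mxE; apply/eqP; have := H i; rewrite negbK.
have [_ _ [x px]] := hpsi.
pose w : X := (x / z 0 i) *: delta_mx 0 i.
have dw : dot z w = x.
  by rewrite dotZr /dot trmx_delta -colE mxE divfK.
have : \sum_v psi (dot z v) = psi x * \sum_v psi (dot z v).
  rewrite [LHS](reindex_inj (addIr w)) mulr_sumr; apply: eq_bigr => t _.
  by rewrite dotDr dw psiD mulrC.
move/eqP; rewrite -subr_eq0 -{1}[\sum_v _]mul1r -mulrBl mulf_eq0 subr_eq0.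
by rewrite eq_sym (negPf px) => /eqP.
Qed.

Definition schrodinger (h : Heis F n) : 'End(V) :=
  linfun (fun f : V => [ffun y : X =>
    (psi (h.2 + dot y (rsubmx h.1) + 2^-1 * dot (lsubmx h.1) (rsubmx h.1))
     * f (y + lsubmx h.1) : C^o)]).

Lemma schrodingerE h (f : V) y :
  schrodinger h f y =
    psi (h.2 + dot y (rsubmx h.1) + 2^-1 * dot (lsubmx h.1) (rsubmx h.1))
    * f (y + lsubmx h.1).
Proof.
rewrite /schrodinger linfun_linearE ?ffunE // => a u v.
by apply/ffunP=> x; rewrite !ffunE mulrDr /GRing.scale /= mulrCA.
Qed.

Lemma schrodinger1 : schrodinger 1%g = \1%VF.
Proof.
apply/lfunP=> f; apply/ffunP=> y; rewrite schrodingerE lfunE /=.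
by rewrite !linear0 dot0r dot0l mulr0 !addr0 psi0 mul1r.
Qed.

Hypothesis two_neq0 : (2 : F) != 0.

Lemma schrodingerM h k :
  schrodinger (h * k)%g = (schrodinger h \o schrodinger k)%VF.
Proof.
apply/lfunP=> f; apply/ffunP=> y; rewrite lfunE /= !schrodingerE.
case: h k => [u a] [v b]; cbv [fst snd].
rewrite [in RHS]mulrA -psiD.
rewrite /mulg /= !linearD /= [y + (_ + _)]addrA; congr (psi _ * _).
rewrite symp_dot !(dotDl, dotDr) [dot (rsubmx u) _]dotC; field; exact: two_neq0.
Qed.

Hypothesis q_neq0 : (#|F|%:R : C) != 0.

(** The elements of X^* act by the characters y |-> psi (y.v), so averaging
    against one of them extracts from a nonzero f a multiple of a delta
    function; the elements of X permute the delta functions transitively. *)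
Lemma schrodinger_irr : lin_irreducible [set: Heis F n]%G schrodinger.
Proof.
split.
  apply/eqP=> E; have : ([ffun=> 1] : V) \in (0%VS : {vspace V}).
    by rewrite -E memvf.
  rewrite memv0 => /eqP/ffunP/(_ 0); rewrite !ffunE => /eqP.
  by rewrite oner_eq0.
move=> U SU; case: (eqVneq U 0%VS) => [|U0]; [by left | right].
have stab h f : f \in U -> schrodinger h f \in U.
  move=> fU; have /subvP := SU h (in_setT _); apply; exact: memv_img.
have [f fU f0] : exists2 f, f \in U & f != 0.
  by exists (vpick U); rewrite ?memv_pick ?vpick0.
have [y0 fy0] : exists y, f y != 0.
  apply/existsP; apply: contraNT f0 => /existsPn H; apply/eqP/ffunP=> i.
  by rewrite ffunE; apply/eqP; have := H i; rewrite negbK.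
pose q := (#|{: X}|%:R : C).
have q0 : q != 0.
  by rewrite /q card_mx mul1n natrX expf_neq0.
pose del y : V := [ffun x => (x == y)%:R].
(* On y the sum has the factor sum_v psi ((y - y0).v). *)
have del0U : del y0 \in U.
  have : \sum_(v : X) psi (- dot y0 v) *: schrodinger (inXs v, 0) f \in U.
    by apply: memv_suml => v _; rewrite memvZ ?stab.
  have -> : \sum_(v : X) psi (- dot y0 v) *: schrodinger (inXs v, 0) f
      = (q * f y0) *: del y0.
    apply/ffunP=> y; rewrite sum_ffunE !ffunE.
    transitivity (\sum_(v : X) psi (dot (y - y0) v) * f y).
      apply: eq_bigr => v _; rewrite ffunE schrodingerE /= /inXs row_mxKl row_mxKr.
      rewrite dot0l mulr0 !addr0 add0r /GRing.scale /= mulrA -psiD dotDl dotNl.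
      by rewrite addrC.
    rewrite -mulr_suml psi_sum_dot subr_eq0 /GRing.scale /=.
    by case: eqP => [->|_]; rewrite ?mulr1 ?mulr0 ?mul0r.
  by move=> /(memvZ (q * f y0)^-1); rewrite scalerA mulVf ?scale1r ?mulf_neq0.
have delU y : del y \in U.
  have := stab (inX (y0 - y), 0) _ del0U.
  congr (_ \in U); apply/ffunP=> x.
  rewrite schrodingerE !ffunE /= /inX row_mxKl row_mxKr !dot0r mulr0 !addr0 psi0.
  rewrite mul1r addrA [x + y0]addrC -addrA -subr_eq0 addrAC subrr add0r.
  by rewrite subr_eq0.
apply/vspaceP=> g; rewrite memvf.
have -> : g = \sum_y (g y : C) *: del y.
  apply/ffunP=> x; rewrite sum_ffunE (bigD1 x) //= big1 => [|y yx].
    by rewrite !ffunE eqxx addr0 /GRing.scale /= mulr1.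
  by rewrite !ffunE eq_sym (negPf yx) /GRing.scale /= mulr0.
by apply: memv_suml => y _; rewrite memvZ.
Qed.

Lemma schrodinger_center t (v : V) : schrodinger (0, t) v = psi t *: v.
Proof.
apply/ffunP=> y; rewrite schrodingerE !ffunE /= !linear0 dot0r dot0l mulr0.
by rewrite !addr0.
Qed.

End Schrodinger.

(** * The Weil representation intertwines the Schroedinger representation *)

Section Intertwining.

Variables (F : finFieldType) (n : nat) (C : fieldType) (psi : F -> C).
Hypothesis hq : (#|F| %% 4 = 3)%N.
Variables (varpi : {unit F}) (tau : {morphism [set: {unit F}] >-> {unit F}}).
Hypothesis htau : is_tau varpi tau.
Hypothesis hpsi : nontriv_add_char psi.
Local Notation m := n.+1.
Local Notation X := 'rV[F]_m.
Local Notation W := 'rV[F]_(m + m).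
Local Notation GLW := {'GL_(m + m)[F]}.
Local Notation V := {ffun X -> C^o}.
Variable pi : GLW -> 'End(V).
Hypothesis hpi : is_linrep (FSp F n) pi.
Hypothesis hweil : weil_formulas psi tau pi.
Local Notation S := (@schrodinger F n C psi).

Lemma two_neq0 : (2 : F) != 0.
Proof.
apply: contraNneq (oneN1_neq hq) => E; rewrite eq_sym -addr_eq0.
by rewrite -[1 + 1]/(2%:R) E.
Qed.

Lemma lambdaE (l : {unit F}) (g : GLW) : similitude l g -> lambda g = l.
Proof.
move=> lg; apply: (similitude_inj (lambdaP _) lg).
by rewrite inE; apply/existsP; exists l.
Qed.

Lemma legendre1 : (legendre (1 : F))%:~R = 1 :> F.
Proof.
by rewrite (legendre_tau hq htau 1%g) morph1 expg1n mulg1.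
Qed.

Lemma alpha_sp (h : Heis F n) (g : GLW) :
  g \in Sp F n -> alpha_fun tau h g = (h.1 *m GLmat g, h.2).
Proof.
rewrite inE => /lambdaE E; rewrite /alpha_fun E morph1 /= legendre1 scale1r.
by rewrite mul1r.
Qed.

Lemma similitude_scalar (a : {unit F}) (g : GLW) :
  GLmat g = (val a)%:M -> similitude (a ^+ 2)%g g.
Proof.
move=> E; apply/similitudeP=> u v; rewrite E !mul_mx_scalar sympZl sympZr.
by rewrite mulrA FinRing.val_unitX.
Qed.

(** The factor tau (a^2) a is a sign, by tau_sq. *)
Lemma alpha_scalar (h : Heis F n) (a : {unit F}) (g : GLW) :
  GLmat g = (val a)%:M ->
  alpha_fun tau h g = (val (tau (a ^+ 2)%g) * val a *: h.1, h.2).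
Proof.
move=> E; rewrite /alpha_fun (lambdaE (similitude_scalar E)) E mul_mx_scalar.
by rewrite scalerA (legendre_tau hq htau) (tau_sq hq htau) mul1r.
Qed.

Definition intertwines (g : GLW) :=
  [forall h : Heis F n,
     (S h \o pi g)%VF == (pi g \o S (alpha_fun tau h g))%VF].

Lemma intertwinesP g :
  reflect (forall h (f : V) y,
             S h (pi g f) y = pi g (S (alpha_fun tau h g) f) y)
          (intertwines g).
Proof.
apply: (iffP forallP) => [H h f y | H h].
  by have /eqP/lfunP/(_ f) := H h; rewrite !lfunE /= => ->.
by apply/eqP/lfunP=> f; apply/ffunP=> y; rewrite !lfunE /= H.
Qed.

Lemma fsp_sub_gsp : FSp F n \subset GSp F n.
Proof.
apply/subsetP=> g; rewrite !inE => /existsP[t /existsP[h /andP[]]].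
rewrite inE => /similitudeP hs /eqP E; apply/existsP; exists (t ^+ 2)%g.
apply/similitudeP=> u v; rewrite E -!scalemxAr sympZl sympZr hs.
by rewrite FinRing.val_unitX mul1r mulrA.
Qed.

Lemma sp_sub_fsp : Sp F n \subset FSp F n.
Proof.
apply/subsetP=> g gSp; rewrite inE; apply/existsP; exists 1%g.
by apply/existsP; exists g; rewrite gSp scale1r eqxx.
Qed.

Definition intertwiners := [set g in FSp F n | intertwines g].

Lemma mem_intertwiners g :
  (g \in intertwiners) = (g \in FSp F n) && intertwines g.
Proof. by rewrite [LHS]inE. Qed.

(** Passing an operator S h through pi g and then through pi k turns h into
    alpha (alpha h g) k, which is alpha h (g k). *)
Lemma intertwiner_group_set : group_set intertwiners.
Proof.
have [pi1 piM] := hpi; have [_ actM] := alpha_act n hq htau.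
apply/group_setP; split=> [|g k].
  rewrite mem_intertwiners group1; apply/intertwinesP=> h f y.
  rewrite pi1 !lfunE /= alpha_sp ?group1 // GLmat1 mulmx1.
  by rewrite -surjective_pairing.
rewrite !mem_intertwiners => /andP[gF /intertwinesP Ig] /andP[kF /intertwinesP Ik].
rewrite groupM //; apply/intertwinesP=> h f y.
rewrite piM // !lfunE /= Ig actM ?(subsetP fsp_sub_gsp) //.
by congr (pi g _ y); apply/ffunP=> x; rewrite Ik.
Qed.

(** On Siegel and Levi elements both sides carry the same value of f, and what
    remains is an identity between the arguments of psi. For omega the two sums
    over X agree term by term once one of them is translated by the
    X^*-component of h: the Fourier transform exchanges translations and
    multiplications by characters. *)
Lemma sp_intertwines : Sp F n \subset intertwiners.
Proof.
have spF := subsetP sp_sub_fsp.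
pose K := Group intertwiner_group_set.
change (Sp F n \subset K); apply: sp_sub_generated => [b sb | a aU |].
- have gSp := siegel_sp sb; rewrite mem_intertwiners spF //=.
  apply/intertwinesP=> h f y.
  have wu := weil_unipotent hweil sb (siegelE b).
  rewrite alpha_sp // schrodingerE !wu schrodingerE; cbv [fst snd].
  case: h => [w t]; cbv [fst snd].
  have -> : w *m GLmat (siegel b) = row_mx (lsubmx w) (lsubmx w *m b + rsubmx w).
    rewrite siegelE -{1}[w]hsubmxK mul_row_block.
    by rewrite !mulmx1 mulmx0 addr0.
  rewrite row_mxKl row_mxKr !mulrA -!(psiD hpsi); congr (psi _ * _).
  rewrite !symp_dot /inX /inXs !row_mxKl !row_mxKr !dot0l !subr0.
  rewrite mulmxDl !(dotDl, dotDr).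
  rewrite [dot (lsubmx w) (y *m b)]dotC dotM sb.
  by field; exact: two_neq0.
- have gSp := levi_sp aU; rewrite mem_intertwiners spF //=.
  apply/intertwinesP=> h f y.
  have wl := weil_levi hweil aU (leviE aU).
  rewrite alpha_sp // schrodingerE !wl schrodingerE; cbv [fst snd].
  case: h => [w t]; cbv [fst snd].
  have -> : w *m GLmat (levi a) = row_mx (lsubmx w *m a) (rsubmx w *m invmx a^T).
    rewrite leviE // -{1}[w]hsubmxK mul_row_block.
    by rewrite !mulmx0 addr0 add0r.
  rewrite row_mxKl row_mxKr !dotM -!mulmxA mulVmx ?unitmx_tr // mulmx1.
  by rewrite mulmxDl mulrCA.
have gSp := weyl_sp F n; rewrite mem_intertwiners spF //=.
apply/intertwinesP=> h f y.
have ww := weil_omega hweil (weylE F n).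
rewrite alpha_sp // schrodingerE !ww.
case: h => [w t]; cbv [fst snd].
have rE (z : W) : z *m GLmat (weyl F n) = row_mx (rsubmx z) (- lsubmx z).
  rewrite weylE -{1}[z]hsubmxK mul_row_block.
  by rewrite !mulmx0 mulmxN !mulmx1 addr0 add0r.
rewrite mulrCA; congr (_ * _); rewrite mulr_sumr.
rewrite [RHS](reindex_inj (addIr (- rsubmx w))).
apply: eq_bigr => x _; rewrite schrodingerE !rE /inX; cbv [fst snd].
rewrite !symp_dot !row_mxKl !row_mxKr subrK !dot0l !subr0 mulrCA [RHS]mulrAC.
rewrite -!(psiD hpsi) mulrC; congr (psi _ * _).
rewrite !(dotDl, dotDr, dotNl, dotNr) [dot x y]dotC.
rewrite [dot (rsubmx w) (lsubmx w)]dotC [dot (rsubmx w) y]dotC.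
by field; exact: two_neq0.
Qed.

(** For a scalar a the operator pi a only involves the sign e = tau (a^2) a, and
    alpha multiplies the W-component of h by the same e; the terms that are
    quadratic in e agree because e^2 = 1. *)
Lemma fsp_intertwines g : g \in FSp F n -> intertwines g.
Proof.
rewrite inE => /existsP[a /existsP[k /andP[kSp /eqP E]]].
pose z : GLW := GLof (val a)%:M.
have zE : GLmat z = (val a)%:M.
  apply: GLofK; rewrite unitmxE det_scalar unitrX //; exact: valP.
have -> : g = (z * k)%g.
  by apply: GLmat_inj; rewrite GLmatM zE mul_scalar_mx.
have zF : z \in FSp F n.
  rewrite inE; apply/existsP; exists a; apply/existsP; exists 1%g.
  by rewrite group1 zE GLmat1 scalemx1 eqxx.
have zI : z \in Group intertwiner_group_set.
  rewrite mem_intertwiners zF; apply/intertwinesP=> h f y.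
  have ws := weil_scalar hweil zE.
  rewrite (alpha_scalar _ zE) schrodingerE !ws schrodingerE.
  case: h => [w t]; cbv [fst snd].
  have e2 := congr1 val (tau_sq hq htau a).
  move: e2; rewrite FinRing.val_unitM !FinRing.val_unitX.
  rewrite !scalerA; set e := _ * val a => e2.
  have {}e2 : e * e = 1 by rewrite -[RHS]e2 /e; ring.
  rewrite mulrCA !linearZ /= !(dotZl, dotZr) -scalerDr.
  by rewrite ![e * (e * _)]mulrA e2 !mul1r.
have : (z * k)%g \in Group intertwiner_group_set.
  by apply: groupM => //; apply: (subsetP sp_intertwines).
by rewrite mem_intertwiners => /andP[].
Qed.

End Intertwining.

(** * The two cosets of F^* Sp(W) in GSp(W) *)

Section Cosets.

Variables (F : finFieldType) (n : nat).
Hypothesis hq : (#|F| %% 4 = 3)%N.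
Variables (varpi : {unit F}) (tau : {morphism [set: {unit F}] >-> {unit F}}).
Hypothesis htau : is_tau varpi tau.
Local Notation m := n.+1.
Local Notation GLW := {'GL_(m + m)[F]}.

Lemma lambda_fsp (x : GLW) : x \in FSp F n -> exists s, lambda x = (s ^+ 2)%g.
Proof.
rewrite inE => /existsP[t /existsP[h /andP[]]].
rewrite inE => /similitudeP hs /eqP E; exists t.
apply: lambdaE; apply/similitudeP=> u v.
by rewrite E -!scalemxAr sympZl sympZr hs FinRing.val_unitX mul1r mulrA.
Qed.

Lemma fsp_lambda (x : GLW) s :
  x \in GSp F n -> lambda x = (s ^+ 2)%g -> x \in FSp F n.
Proof.
move=> xG xs; have /similitudeP lx := lambdaP xG.
have s0 : val s != 0 by rewrite -unitfE; exact: valP.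
pose h : GLW := GLof ((val s)^-1 *: GLmat x).
have hE : GLmat h = (val s)^-1 *: GLmat x.
  by apply: GLofK; rewrite unitmxZ ?GLmat_unit // unitfE invr_neq0.
rewrite inE; apply/existsP; exists s; apply/existsP; exists h.
rewrite hE scalerA mulfV // scale1r eqxx andbT inE; apply/similitudeP=> u v.
rewrite hE -!scalemxAr sympZl sympZr lx xs FinRing.val_unitX.
by rewrite !mulrA mulfVK // mulVf.
Qed.

(** An element of similitude factor -1, which is not a square; it represents the
    coset of GSp(W) other than F^* Sp(W). *)
Definition gspN1 : GLW := GLof (block_mx 1%:M 0 0 (- 1%:M)).

Lemma gspN1_similitude : similitude (unitN1 F) gspN1.
Proof.
apply/similitude_mx; rewrite GLofK; last first.
  rewrite unitmxE det_ublock det1 mul1r -unitmxE -scaleN1r unitmxZ ?unitmx1 //.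
  by rewrite unitrN1.
rewrite /sympJ tr_block_mx linearN /= !trmx1 !trmx0 !mulmx_block ?simp_mx.
by rewrite scaleN1r opp_block_mx ?simp_mx.
Qed.

Lemma gspN1_gsp : gspN1 \in GSp F n.
Proof.
by rewrite inE; apply/existsP; exists (unitN1 F); exact: gspN1_similitude.
Qed.

Lemma gspN1_notin_fsp : gspN1 \notin FSp F n.
Proof.
apply/negP=> /lambda_fsp[s]; rewrite (lambdaE gspN1_similitude) => E.
by have := N1_nsq hq s; rewrite E eqxx.
Qed.

Lemma lambda_notin_fsp (x : GLW) : x \in GSp F n -> x \notin FSp F n ->
  exists s, lambda x = (unitN1 F * s ^+ 2)%g.
Proof.
move=> xG xF; have [s [Es|Es]] := unit_sq_or hq (lambda x); last by exists s.
by rewrite (fsp_lambda xG Es) in xF.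
Qed.

Lemma gsp_coset (x : GLW) :
  x \in GSp F n -> x \notin FSp F n -> (x * gspN1^-1)%g \in FSp F n.
Proof.
move=> xG xF; have [s Es] := lambda_notin_fsp xG xF.
have yG : (x * gspN1^-1)%g \in GSp F n by rewrite groupM ?groupV ?gspN1_gsp.
apply: (fsp_lambda yG (s := s)); apply: (mulIg (unitN1 F)).
have <- := lambdaE gspN1_similitude.
rewrite -(lambdaM yG gspN1_gsp) mulgKV Es (lambdaE gspN1_similitude).
exact: unit_mulC.
Qed.

Lemma legendre_fsp (x : GLW) : x \in FSp F n ->
  (legendre (val (lambda x)))%:~R = 1 :> F.
Proof.
case/lambda_fsp=> s ->.
by rewrite (legendre_tau hq htau) (tau_sq hq htau).
Qed.

(** On the nontrivial coset alpha inverts the centre of the Heisenberg group. *)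
Lemma legendre_notin_fsp (x : GLW) : x \in GSp F n -> x \notin FSp F n ->
  (legendre (val (lambda x)))%:~R = -1 :> F.
Proof.
move=> xG xF; have [s ->] := lambda_notin_fsp xG xF.
have [_ _ tau1] := htau.
rewrite (legendre_tau hq htau) morphM ?inE // tau1 mul1g.
by rewrite [(unitN1 F * _)%g]unit_mulC mulgA (tau_sq hq htau) mul1g.
Qed.

End Cosets.

(** * Extending the induced representation *)

Section InducedRepresentation.

Variables (K : fieldType) (gT : finGroupType) (G H : {group gT}).
Variables (V : vectType K) (pi : gT -> 'End(V)).
Local Notation rho := (ind_rep G H pi).

Lemma ind_repM g k : g \in G -> k \in G -> rho (g * k)%g = (rho g \o rho k)%VF.
Proof.
move=> gG kG; apply/lfunP=> f; apply: val_inj; apply/ffunP=> x.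
by rewrite lfunE /= !ind_repE ?groupM // mulgA.
Qed.

Lemma ind_rep1 : rho 1%g = \1%VF.
Proof.
apply/lfunP=> f; apply: val_inj; apply/ffunP=> x.
by rewrite lfunE /= ind_repE ?group1 // mulg1.
Qed.

End InducedRepresentation.

Section Extension.

Variables (F : finFieldType) (n : nat) (C : fieldType) (psi : F -> C).
Hypothesis hq : (#|F| %% 4 = 3)%N.
Variables (varpi : {unit F}) (tau : {morphism [set: {unit F}] >-> {unit F}}).
Hypothesis htau : is_tau varpi tau.
Hypothesis hpsi : nontriv_add_char psi.
Local Notation m := n.+1.
Local Notation X := 'rV[F]_m.
Local Notation GLW := {'GL_(m + m)[F]}.
Local Notation V := {ffun X -> C^o}.
Variable pi : GLW -> 'End(V).
Hypothesis hpi : is_linrep (FSp F n) pi.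
Hypothesis hweil : weil_formulas psi tau pi.
Local Notation S := (@schrodinger F n C psi).
Local Notation G := (GSp F n).
Local Notation H := (FSp F n).
Local Notation I := (ind_space G H pi).
Local Notation rho := (ind_rep G H pi).
Local Notation to := (alpha n hq htau).
Local Notation ev f := (vsval f : {ffun GLW -> V}).
Local Notation hact := (alpha_fun tau).

Lemma alpha_fun1 (h : Heis F n) : hact h 1%g = h.
Proof. exact: (act1 to h). Qed.

Lemma alpha_funM (h : Heis F n) g k : g \in G -> k \in G ->
  hact h (g * k)%g = hact (hact h g) k.
Proof. by move=> gG kG; exact: ((alpha_act n hq htau).2 h g k gG kG). Qed.

Lemma alpha_fun_morph (h k : Heis F n) g : g \in G ->
  hact (h * k)%g g = (hact h g * hact k g)%g.
Proof. by move=> gG; exact: (gactM to gG (in_setT h) (in_setT k)). Qed.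

Lemma alpha_fun_unit g : g \in G -> hact (1%g : Heis F n) g = 1%g.
Proof. by move=> gG; exact: (gact1 to gG). Qed.

Lemma pi_schrodinger h g f : g \in H -> S h (pi g f) = pi g (S (hact h g) f).
Proof.
move=> gH; have /intertwinesP E := fsp_intertwines hq htau hpsi hpi hweil gH.
by apply/ffunP=> y; rewrite E.
Qed.

Lemma ev_ind (f : subvs_of I) k x :
  k \in H -> x \in G -> ev f (k * x)%g = pi k (ev f x).
Proof. by move=> kH xG; have /mem_ind_space[-> //] := subvsP f. Qed.

Lemma ev_out (f : subvs_of I) x : x \notin G -> ev f x = 0.
Proof.
by move=> xG; have /mem_ind_space[_ -> //] := subvsP f; rewrite in_setC.
Qed.

(** At x the Heisenberg element is transported by x^-1. This is forced by
    [1, h] [x^-1, 0] = [x^-1, alpha h x^-1] and by letting S give the action of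
    the Heisenberg group on the value at the identity. *)
Definition ind_heis (h : Heis F n) : 'End(subvs_of I) :=
  linfun (fun f : subvs_of I => vsproj I [ffun x => S (hact h x^-1%g) (ev f x)]).

(** The function given by the formula is again in the induced space because pi
    intertwines S with its twists. *)
Lemma ind_heisE h f x : ev (ind_heis h f) x = S (hact h x^-1%g) (ev f x).
Proof.
have lin : linear (fun f : subvs_of I =>
    vsproj I [ffun x => S (hact h x^-1%g) (ev f x)]).
  move=> a u v; rewrite -(linearP (vsproj I)); congr vsproj.
  by apply/ffunP=> y; rewrite !ffunE !linearP.
rewrite /ind_heis (linfun_linearE lin) vsprojK ?ffunE //; apply/mem_ind_space.
split=> [k y kH yG | y]; last first.
  by rewrite in_setC => yG; rewrite ffunE ev_out ?linear0.
rewrite !ffunE.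
have kG := subsetP (fsp_sub_gsp F n) k kH.
rewrite invMg ev_ind // alpha_funM ?groupV // pi_schrodinger //.
by rewrite -alpha_funM ?groupV // mulVg alpha_fun1.
Qed.

(** The inducing representation embeds in the induced one as the functions
    supported on F^* Sp(W). *)
Definition ind_embed (v : V) : subvs_of I :=
  vsproj I [ffun x => if x \in H then pi x v else 0].

Lemma ind_embedE v x : ev (ind_embed v) x = if x \in H then pi x v else 0.
Proof.
have [pi1 piM] := hpi.
rewrite /ind_embed vsprojK ?ffunE //; apply/mem_ind_space.
split=> [k y kH yG | y]; rewrite !ffunE.
  by rewrite groupMl //; case: ifP => yH; rewrite ?linear0 // piM // lfunE.
by rewrite in_setC; case: ifP => // /(subsetP (fsp_sub_gsp F n)) ->.
Qed.

Lemma ind_embed_linear : linear ind_embed.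
Proof.
move=> a u v; apply: val_inj; apply/ffunP=> x.
rewrite linearP !ffunE !ind_embedE; case: ifP => _; first by rewrite linearP.
by rewrite scaler0 addr0.
Qed.

Lemma ind_heis_embed h v : ind_heis h (ind_embed v) = ind_embed (S h v).
Proof.
apply: val_inj; apply/ffunP=> x; rewrite ind_heisE !ind_embedE.
case: ifP => [xH|_]; last by rewrite linear0.
have xG := subsetP (fsp_sub_gsp F n) x xH.
by rewrite pi_schrodinger // -alpha_funM ?groupV // mulVg alpha_fun1.
Qed.

(** A function on the two cosets of F^* Sp(W) is determined by its values at 1
    and at diag(1, -1). *)
Lemma ind_decomp (f : subvs_of I) :
  f = ind_embed (ev f 1%g)
      + rho (gspN1 F n)^-1%g (ind_embed (ev f (gspN1 F n))).
Proof.
have [pi1 piM] := hpi; have cG := gspN1_gsp F n.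
apply: val_inj; apply/ffunP=> x; rewrite linearD /= ffunE.
rewrite ind_repE ?groupV // !ind_embedE.
have [xG|xG] := boolP (x \in G); last first.
  rewrite ev_out // !ifF ?addr0 //; apply: contraNF xG.
    by move/(subsetP (fsp_sub_gsp F n)); rewrite groupMr ?groupV.
  exact: (subsetP (fsp_sub_gsp F n)).
have [xH|xH] := boolP (x \in H).
  rewrite -ev_ind // mulg1 ifF ?addr0 // groupMl // groupV.
  exact/negbTE/gspN1_notin_fsp.
by rewrite gsp_coset // -ev_ind ?gsp_coset // mulgKV add0r.
Qed.

Definition ext_rep (u : sdprod_by to) : 'End(subvs_of I) :=
  (rho u.1 \o ind_heis u.2)%VF.

Lemma sdprod_fst (u : sdprod_by to) : u.1 \in G.
Proof. by case: u => -[g h] /= /setXP[]. Qed.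

Lemma sdpair2E g : g \in G -> pair_of_sd (sdpair2 to g) = (g, 1%g).
Proof.
move=> gG; rewrite /sdpair2.
rewrite (_ : pair_of_sd _ = val (insubd (sdprod_one to) (g, 1%g))) //.
by rewrite insubdK // inE /= gG inE.
Qed.

Lemma sdpair1E h : pair_of_sd (sdpair1 to h) = (1%g, h).
Proof.
rewrite /sdpair1 (_ : pair_of_sd _ = val (insubd (sdprod_one to) (1%g, h))) //.
by rewrite insubdK // inE /= group1 inE.
Qed.

Lemma ind_heis1 : ind_heis 1%g = \1%VF.
Proof.
apply/lfunP=> f; apply: val_inj; apply/ffunP=> x; rewrite lfunE /= ind_heisE.
have [xG|xG] := boolP (x \in G); last by rewrite ev_out ?linear0.
by rewrite alpha_fun_unit ?groupV // schrodinger1 // lfunE.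
Qed.

Lemma ind_heisM h k : ind_heis (h * k)%g = (ind_heis h \o ind_heis k)%VF.
Proof.
apply/lfunP=> f; apply: val_inj; apply/ffunP=> x; rewrite lfunE /= !ind_heisE.
have [xG|xG] := boolP (x \in G); last by rewrite ev_out ?linear0.
rewrite alpha_fun_morph ?groupV // schrodingerM //; first by rewrite lfunE.
exact: two_neq0 hq.
Qed.

Lemma ind_heis_rho h g : g \in G ->
  (ind_heis h \o rho g)%VF = (rho g \o ind_heis (hact h g))%VF.
Proof.
move=> gG; apply/lfunP=> f; apply: val_inj; apply/ffunP=> x.
rewrite !lfunE /= ind_heisE !ind_repE // ind_heisE.
have [xG|xG] := boolP (x \in G); last first.
  by rewrite ev_out ?linear0 // groupMr.
have xVG : x^-1%g \in G by rewrite groupV.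
have xgVG : (x * g)^-1%g \in G by rewrite groupV groupM.
by rewrite -(alpha_funM _ gG xgVG) invMg mulKVg.
Qed.

Lemma ext_rep_linrep : is_linrep [set: sdprod_by to]%G ext_rep.
Proof.
split=> [|u v _ _]; first by rewrite /ext_rep /= ind_rep1 ind_heis1 comp_lfun1l.
rewrite /ext_rep /= ind_repM ?sdprod_fst // ind_heisM -!comp_lfunA.
congr (_ \o _)%VF.
by rewrite !comp_lfunA ind_heis_rho ?sdprod_fst.
Qed.

Lemma ext_rep_sdpair2 g : g \in G -> ext_rep (sdpair2 to g) = rho g.
Proof. by move=> gG; rewrite /ext_rep sdpair2E //= ind_heis1 comp_lfun1r. Qed.

Lemma ext_rep_sdpair1 h : ext_rep (sdpair1 to h) = ind_heis h.
Proof. by rewrite /ext_rep sdpair1E /= ind_rep1 comp_lfun1l. Qed.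

(** At x the sum has the factor q if x is in F^* Sp(W), where the centre acts by
    psi, and the factor sum_t psi (- 2 t) = 0 otherwise. *)
Lemma center_projection (f : subvs_of I) :
  \sum_t psi (- t) *: ind_heis (0, t) f = (#|F|)%:R *: ind_embed (ev f 1%g).
Proof.
apply: val_inj; apply/ffunP=> x.
rewrite linear_sum sum_ffunE linearZ ffunE ind_embedE.
under eq_bigr do rewrite linearZ ffunE ind_heisE.
have [xG|xG] := boolP (x \in G); last first.
  rewrite ifF; last by apply: contraNF xG; apply: (subsetP (fsp_sub_gsp F n)).
  by rewrite scaler0 big1 // => t _; rewrite ev_out // linear0 scaler0.
have toE t : hact ((0, t) : Heis F n) x^-1%g
    = (0, (legendre (val (lambda x^-1%g)))%:~R * t).
  by rewrite /alpha_fun /= mul0mx scaler0.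
under eq_bigr do rewrite toE schrodinger_center scalerA -(psiD hpsi).
rewrite -scaler_suml; have [xH|xH] := boolP (x \in H).
  rewrite -ev_ind // mulg1 (legendre_fsp hq htau) ?groupV //; congr (_ *: _).
  under eq_bigr do rewrite mul1r addNr (psi0 hpsi).
  by rewrite sumr_const.
rewrite scaler0 (legendre_notin_fsp hq htau) ?groupV //.
under eq_bigr do rewrite mulN1r -[- _]mulN1r -mulrDl.
by rewrite psi_sum_mul ?scale0r // -opprD oppr_eq0; apply: two_neq0 hq.
Qed.

Hypothesis q_neq0 : (#|F|%:R : C) != 0.

(** The vectors v whose image under ind_embed lies in an invariant subspace U
    form a Heisenberg submodule U' of C[X]. If U' is everything, then so is U,
    by ind_decomp. If U' = 0, then center_projection, applied to the translates
    rho x f of f in U, gives that all the values f x vanish. *)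
Lemma ext_rep_irr : lin_irreducible [set: sdprod_by to]%G ext_rep.
Proof.
have [pi1 piM] := hpi.
have [V0 Sirr] := schrodinger_irr n hpsi q_neq0.
have embed1 v : ev (ind_embed v) 1%g = v by rewrite ind_embedE group1 pi1 lfunE.
split.
  apply: contraNneq V0 => E; rewrite -subv0; apply/subvP=> v _.
  rewrite memv0; have : ind_embed v \in (0%VS : {vspace subvs_of I}).
    by rewrite -E memvf.
  by rewrite memv0 => /eqP E0; rewrite -(embed1 v) E0 linear0 ffunE.
move=> U PU; case: (eqVneq U 0%VS) => [|U0]; [by left | right].
have stab u f : f \in U -> ext_rep u f \in U.
  move=> fU; have /subvP := PU u (in_setT _); apply; exact: memv_img.
have stabG g f : g \in G -> f \in U -> rho g f \in U.
  by move=> gG fU; rewrite -ext_rep_sdpair2 // stab.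
have stabH h f : f \in U -> ind_heis h f \in U.
  by move=> fU; rewrite -ext_rep_sdpair1 stab.
have embedE := linfun_linearE ind_embed_linear.
pose U' : {vspace V} := (linfun ind_embed @^-1: U)%VS.
have memU' v : (v \in U') = (ind_embed v \in U) by rewrite /U' -memv_preim embedE.
have {Sirr} : U' = 0%VS \/ U' = fullv.
  apply: Sirr => h _; apply/subvP=> w /memv_imgP[v]; rewrite memU' => vU' ->.
  by rewrite memU' -ind_heis_embed stabH.
case=> [U'0 | U'1]; last first.
  apply/vspaceP=> f; rewrite memvf (ind_decomp f).
  by rewrite memvD ?stabG ?groupV ?gspN1_gsp // -memU' U'1 memvf.
have /eqP[] := U0; apply/eqP; rewrite -subv0; apply/subvP=> f fU.
rewrite memv0; apply/eqP; apply: val_inj; apply/ffunP=> x; rewrite linear0 ffunE.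
have [xG|xG] := boolP (x \in G); last by rewrite ev_out.
have : ev f x \in U'.
  rewrite memU'; have := center_projection (rho x f).
  rewrite ind_repE // mul1g => /(congr1 ( *:%R (#|F|%:R)^-1)).
  rewrite scalerA mulVf // scale1r => <-.
  by rewrite memvZ // memv_suml // => t _; rewrite memvZ ?stabH ?stabG.
by rewrite U'0 memv0 => /eqP.
Qed.

End Extension.

(** * The extension theorem *)

Theorem lemma2p5 (R : realType) (F : finFieldType) (n : nat)
    (hq : (#|F| %% 4 = 3)%N)
    (varpi : {unit F}) (tau : {morphism [set: {unit F}] >-> {unit F}})
    (htau : is_tau varpi tau)
    (psi : F -> complex R) (hpsi : nontriv_add_char psi)
    (pi : {'GL_(n.+1 + n.+1)[F]} ->
          'End({ffun 'rV[F]_n.+1 -> (complex R)^o}))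
    (hpi : is_linrep (FSp F n) pi) (hweil : weil_formulas psi tau pi) :
  let rho := ind_rep (GSp F n) (FSp F n) pi in
  let to := alpha n hq htau in
  exists Pi : sdprod_by to -> 'End(subvs_of (ind_space (GSp F n) (FSp F n) pi)),
    [/\ is_linrep [set: sdprod_by to]%G Pi,
        {in GSp F n, forall g, Pi (sdpair2 to g) = rho g}
      & lin_irreducible [set: sdprod_by to]%G Pi].
Proof.
move=> rho to; exists (@ext_rep _ _ _ psi hq _ _ htau pi); split.
- exact: ext_rep_linrep.
- exact: ext_rep_sdpair2.
apply: ext_rep_irr => //.
by rewrite Num.Theory.pnatr_eq0 -lt0n; apply/card_gt0P; exists 0.
Qed.
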